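(* For every real constant $K\ge 2$ there is $n_0=n_0(K)$ such that for all integers $n\ge n_0$, $$f(n,K)\ \le\ 7K\,\frac{n}{\log_2 n}.$$
   Context: All graphs are finite and simple. For a graph $G$, $\Delta(G)$ and $\delta(G)$ denote its maximum and minimum degree, and $G[U]$ denotes the subgraph of $G$ induced on $U\subseteq V(G)$. For a real $c\ge 1$, a graph $G$ is $c$-nearly regular if $\Delta(G)\le c\cdot\delta(G)$. Define $f(G,c)=\max\{|U| : U\subseteq V(G),\ G[U]\text{ is } c\text{-nearly regular}\}$ and $f(n,c)=\min\{f(G,c): |V(G)|=n\}$. *)

(* Defs.v *)
From HB Require Import structures.
From mathcomp Require Import all_boot all_order all_algebra.
From mathcomp Require Import reals exp.

Set Implicit Arguments.
Unset Strict Implicit.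
Unset Printing Implicit Defensive.

Import Order.TTheory GRing.Theory Num.Theory.

Local Open Scope ring_scope.

Definition is_simple_graph (T : finType) (e : {ffun T * T -> bool}) : bool :=
  [forall x, ~~ e (x, x)] && [forall x, forall y, e (x, y) == e (y, x)].

(* Adjacency is a finite function so that the graphs on T form a finType, over
   which the minimum in [fmin] is taken. *)
Record sgraph (T : finType) := SGraph {
  sgraph_ffun :> {ffun T * T -> bool};
  _ : is_simple_graph sgraph_ffun
}.

HB.instance Definition _ (T : finType) := [isSub for @sgraph_ffun T].
HB.instance Definition _ (T : finType) := [Finite of sgraph T by <:].

Definition adj (T : finType) (G : sgraph T) : rel T := fun x y => G (x, y).

Lemma adj_irrefl (T : finType) (G : sgraph T) : irreflexive (adj G).
Proof.
move=> x; apply: negbTE.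
by case/andP: (valP G) => /forallP/(_ x).
Qed.

Lemma adj_sym (T : finType) (G : sgraph T) : symmetric (adj G).
Proof.
move=> x y; apply/eqP.
by case/andP: (valP G) => _ /forallP/(_ x)/forallP/(_ y).
Qed.

Fact mk_sgraph_subproof (T : finType) (e : rel T) :
  irreflexive e -> symmetric e ->
  is_simple_graph [ffun p : T * T => e p.1 p.2].
Proof.
move=> irr_e sym_e; apply/andP; split; apply/forallP => x.
  by rewrite ffunE /= irr_e.
by apply/forallP => y; rewrite !ffunE /= sym_e.
Qed.

Definition mk_sgraph (T : finType) (e : rel T)
    (irr_e : irreflexive e) (sym_e : symmetric e) : sgraph T :=
  SGraph (mk_sgraph_subproof irr_e sym_e).

Lemma mk_sgraphE (T : finType) (e : rel T)
    (irr_e : irreflexive e) (sym_e : symmetric e) :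
  adj (mk_sgraph irr_e sym_e) =2 e.
Proof. by move=> x y; rewrite /adj ffunE. Qed.

Definition induced (T : finType) (G : sgraph T) (U : {set T}) :
    sgraph {x : T | x \in U} :=
  @mk_sgraph {x : T | x \in U} (fun x y => adj G (val x) (val y))
    (fun x => adj_irrefl G (val x)) (fun x y => adj_sym G (val x) (val y)).

Definition degree (T : finType) (G : sgraph T) (x : T) : nat :=
  #|[set y | adj G x y]|.

Definition max_degree (T : finType) (G : sgraph T) : nat :=
  (\max_(x : T) degree G x)%N.

(* Every degree is below #|T|, so the neutral element #|T| only matters for
   the graph without vertices, whose minimum degree is then 0. *)
Definition min_degree (T : finType) (G : sgraph T) : nat :=
  \big[minn/#|T|]_(x : T) degree G x.

Definition nearly_regular (R : realType) (c : R) (T : finType) (G : sgraph T) :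
    bool :=
  (max_degree G)%:R <= c * (min_degree G)%:R.

Definition fgraph_max (R : realType) (T : finType) (G : sgraph T) (c : R) :
    nat :=
  (\max_(U : {set T} | nearly_regular c (induced G U)) #|U|)%N.

(* Up to isomorphism every graph on n vertices is a graph on 'I_n. Since
   [fgraph_max G c <= n] for all of these and there is at least one, the
   neutral element n does not affect the minimum (see [fmin_attained]). *)
Definition fmin (R : realType) (n : nat) (c : R) : nat :=
  \big[minn/n]_(G : sgraph 'I_n) fgraph_max G c.

Lemma fmin_le (R : realType) (n : nat) (c : R) (G : sgraph 'I_n) :
  (fmin n c <= fgraph_max G c)%N.
Proof.
rewrite /fmin; elim: (index_enum _) (mem_index_enum G) => [//|H s IHs].
rewrite inE big_cons geq_min => /predU1P[<-|/IHs ->]; first by rewrite leqnn.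
by rewrite orbT.
Qed.

Lemma fmin_attained (R : realType) (n : nat) (c : R) :
  exists G : sgraph 'I_n, fmin n c = fgraph_max G c.
Proof.
pose G0 : sgraph 'I_n :=
  @mk_sgraph 'I_n (fun _ _ => false) (fun=> erefl) (fun _ _ => erefl).
have le_n : (fgraph_max G0 c <= n)%N.
  apply/bigmax_leqP => U _; rewrite -[leqRHS]card_ord.
  exact: max_card.
have [eq_n|//] : fmin n c = n \/
    exists G : sgraph 'I_n, fmin n c = fgraph_max G c.
  rewrite /fmin; elim/big_ind: _ => [|x y hx hy|G _]; first by left.
  - by rewrite /minn; case: ifP.
  - by right; exists G.
exists G0; apply/eqP; rewrite eqn_leq fmin_le /=.
by rewrite eq_n.
Qed.

Definition log2 (R : realType) (x : R) : R := ln x / ln 2.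

(* Main.v *)
(** Take the disjoint union of cliques with M/1, M/2, M/3, ... vertices (rounded
    down), where M is about 7n/log n; the harmonic sum makes their total size at
    least n, and we keep n of the vertices.  At most M/m of these cliques have
    m or more vertices.  An induced subgraph with minimum degree a and maximum
    degree at most Ka only meets cliques of size at least a+1, and meets each
    of them in at most Ka+1 <= K(a+1) vertices, so it has at most KM vertices. *)
Require Import Defs.
From HB Require Import structures.
From mathcomp Require Import all_boot all_order all_algebra.
From mathcomp Require Import reals exp.
From mathcomp Require Import zify.

Import Order.TTheory GRing.Theory Num.Theory.

Local Open Scope ring_scope.

Set Implicit Arguments.
Unset Strict Implicit.
Unset Printing Implicit Defensive.

Section CliqueUnion.

Variables (T C : finType) (col : T -> C).

Definition same_col (x y : T) := (x != y) && (col x == col y).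

Lemma same_col_irrefl : irreflexive same_col.
Proof. by move=> x; rewrite /same_col eqxx. Qed.

Lemma same_col_sym : symmetric same_col.
Proof. by move=> x y; rewrite /same_col eq_sym (eq_sym (col x)). Qed.

Definition clique_union : sgraph T := mk_sgraph same_col_irrefl same_col_sym.

(** The neighbours of [x] are the other vertices of [U] with its colour; the successor counts [x]
    itself. *)
Lemma degree_induced_clique_union (U : {set T}) (x : {x : T | x \in U}) :
  (degree (induced clique_union U) x).+1 =
  #|[set y in U | col y == col (val x)]|.
Proof.
rewrite (cardsD1 (val x)) inE eqxx (valP x) /= add1n; congr _.+1.
rewrite /degree -(card_imset _ val_inj); apply: eq_card => y.
rewrite !inE; apply/imsetP/idP => [[z + ->]|/and3P[yx yU /eqP cyx]].
  rewrite inE !mk_sgraphE /same_col => /andP[xz /eqP->].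
  by rewrite eq_sym xz (valP z) eqxx.
exists (exist _ y yU) => //.
by rewrite inE !mk_sgraphE /same_col /= eq_sym yx cyx eqxx.
Qed.

End CliqueUnion.

Lemma min_degree_le (T : finType) (G : sgraph T) (x : T) :
  (min_degree G <= degree G x)%N.
Proof.
rewrite /min_degree; elim: (index_enum _) (mem_index_enum x) => // y s IHs.
rewrite inE big_cons geq_min => /predU1P[<-|/IHs ->]; first by rewrite leqnn.
by rewrite orbT.
Qed.

Lemma nearly_regular_clique_union (R : realType) (K : R) (T C : finType)
    (col : T -> C) (M : nat) (U : {set T}) : 1 <= K ->
  (forall m, (m * #|[set c | m <= #|[set x | col x == c]|]| <= M)%N) ->
  nearly_regular K (induced (clique_union col) U) ->
  #|U|%:R <= K * M%:R.
Proof.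
move=> K1 hM; rewrite /nearly_regular.
set H := induced _ _; set a := min_degree H; set b := max_degree H => hab.
(* [U] can meet only the colour classes in [big], and the hypothesis on [M] at [m = a + 1] bounds
   their number. *)
set big := [set c | a.+1 <= #|[set x | col x == c]|]%N.
have cU x : x \in U ->
    (a.+1 <= #|[set y in U | col y == col x]| <= b.+1)%N.
  move=> xU; have := @degree_induced_clique_union T C col U (exist _ x xU).
  move=> /= <-; rewrite !ltnS min_degree_le /=.
  exact: (leq_bigmax (F := degree H)).
have hU : (#|U| <= #|big| * b.+1)%N.
  rewrite -sum1_card (partition_big col (mem big)) /=; last first.
    move=> x xU; rewrite inE; have /andP[/leq_trans-> //] := cU _ xU.
    by apply/subset_leq_card/subsetP => y; rewrite !inE => /andP[].
  rewrite -sum_nat_const; apply: leq_sum => c _; rewrite sum1dep_card.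
  have [->|[x]] := set_0Vmem [set y | (y \in U) && (col y == c)].
    by rewrite cards0.
  by rewrite inE => /andP[xU /eqP <-]; have /andP[] := cU _ xU.
(* As [1 <= K], the extra vertex is absorbed: [b + 1 <= K a + 1 <= K (a + 1)]. *)
have hb : b.+1%:R <= K * a.+1%:R by rewrite -!natr1 mulrDr mulr1 lerD.
have K0 : 0 <= K by apply: le_trans K1.
apply: (@le_trans _ _ (#|big|%:R * (K * a.+1%:R))).
  apply: le_trans (ler_wpM2l (ler0n _ _) hb).
  by rewrite -natrM ler_nat.
by rewrite mulrCA -natrM ler_wpM2l // ler_nat mulnC hM.
Qed.

(** At least [n] pairs [(j, i)] with [i < s j] exist. Inject the vertices into these pairs and
    colour each by its first component. *)
Lemma exists_coloring (n N : nat) (s : 'I_N -> nat) :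
  (n <= \sum_(j < N) s j)%N ->
  exists col : 'I_n -> 'I_N,
    forall j, (#|[set x | col x == j]| <= s j)%N.
Proof.
pose S := {j : 'I_N & 'I_(s j)}.
have cardS : #|{: S}| = (\sum_(j < N) s j)%N.
  rewrite card_tagged sumnE big_map big_enum.
  by apply: eq_bigr => j _; rewrite card_ord.
rewrite -cardS => le_n.
pose g (i : 'I_n) : S := enum_val (widen_ord le_n i).
have g_inj : injective g.
  by move=> i j /enum_val_inj/(congr1 val)/= /val_inj.
exists (fun i => tag (g i)) => j.
rewrite -(card_imset _ g_inj) -[s j]card_ord -cardsT.
have /card_imset <- : injective (fun i : 'I_(s j) => Tagged (fun j => 'I_(s j)) i).
  by move=> x y /eqP; rewrite eq_Tagged => /eqP.
apply/subset_leq_card/subsetP => _ /imsetP[i + ->]; rewrite inE.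
by case: (g i) => j' i' /= /eqP <-; apply: imset_f.
Qed.

(** For [m > 0], [m <= M %/ j.+1] is equivalent to [j.+1 <= M %/ m], which holds for at most
    [M %/ m] indices. *)
Lemma card_harmonic_ge (M N m : nat) :
  (m * #|[set j : 'I_N | m <= M %/ j.+1]| <= M)%N.
Proof.
have [->//|m0] := posnP m.
have le_dv : (#|[set j : 'I_N | m <= M %/ j.+1]| <= M %/ m)%N.
  rewrite cardE -(size_map val) -[leqRHS](size_iota 0).
  apply: uniq_leq_size; first by rewrite (map_inj_uniq val_inj) enum_uniq.
  move=> _ /mapP[j + ->]; rewrite mem_enum inE mem_iota add0n /=.
  by rewrite !leq_divRL // mulnC.
by rewrite mulnC -leq_divRL.
Qed.

(* The 2^k terms with 2^k <= j < 2^(k+1) add up to at least M/2 - 2^k. *)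
Lemma harmonic_sum_ge (M k : nat) :
  (k * M <= (\sum_(j < 2 ^ k) M %/ j.+1 + 2 ^ k) * 2)%N.
Proof.
elim: k => // k IHk; rewrite -(big_mkord xpredT (fun j => M %/ j.+1)%N).
have le2 : (2 ^ k <= 2 ^ k.+1)%N by rewrite leq_exp2l.
rewrite (@big_cat_nat _ _ _ (2 ^ k)) //= big_mkord.
have : (2 ^ k * (M %/ 2 ^ k.+1) <= \sum_(2 ^ k <= j < 2 ^ k.+1) M %/ j.+1)%N.
  have -> : (2 ^ k * (M %/ 2 ^ k.+1) =
             \sum_(2 ^ k <= j < 2 ^ k.+1) M %/ 2 ^ k.+1)%N.
    by rewrite sum_nat_const_nat expnS mul2n -addnn addnK.
  rewrite !big_nat; apply: leq_sum => j /andP[_ lt_j].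
  exact: leq_div2l.
(* Rounding costs the new block at most [2 ^ k], which together with the earlier error [2 ^ k] gives
   [2 ^ k.+1]. *)
have := ltn_ceil M (expn_gt0 2 k.+1); move: IHk; rewrite expnS.
set q := (M %/ _)%N; set S1 := (\sum_(i < _) _)%N.
set S2 := (\sum_(_ <= _ < _) _)%N; set p := (2 ^ k)%N.
nia.
Qed.

Lemma log2_le (R : realType) (n t : nat) : (0 < n)%N -> (n <= 2 ^ t)%N ->
  log2 n%:R <= t%:R :> R.
Proof.
move=> n0 le_n; have ln2 : 0 < ln 2 :> R by rewrite ln_gt0 // ltr1n.
rewrite /log2 ler_pdivrMr // mulr_natl -lnXn // ler_ln ?posrE ?ltr0n //.
  by rewrite -natrX ler_nat.
by rewrite exprn_gt0.
Qed.

Theorem proposition1p5 (R : realType) (K : R) (hK : 2 <= K) :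
  exists n0 : nat, forall n : nat, (n0 <= n)%N ->
    (fmin n K)%:R <= 7 * K * (n%:R / log2 n%:R).
Proof.
(* The threshold 16 yields [t >= 4], exactly what [5 (t - 1) >= 3 (t + 1)] needs below. *)
exists 16%N => n n16; have n0 : (0 < n)%N by apply: leq_trans n16.
pose t := trunc_log 2 n.
have t4 : (4 <= t)%N by rewrite trunc_log_max.
have /andP[tn nt] := trunc_log_bounds (isT : (1 < 2)%N) n0.
rewrite -/t in tn nt.
pose M := (7 * n %/ t.+1)%N.
have K1 : 1 <= K by apply: le_trans hK; rewrite ler1n.
(* Since [t < 2 ^ t <= n], rounding leaves [(t + 1) M >= 7 n - t > 6 n], hence [(t - 1) M >= 3.6 n].
   The harmonic bound loses [2 ^ t <= n], so twice the sum is at least [2.6 n]. *)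
have nsum : (n <= \sum_(j < 2 ^ t.-1) M %/ j.+1)%N.
  have tlt : (t < 2 ^ t)%N by apply: ltn_expl.
  have hM : (7 * n < M.+1 * t.+1)%N by apply: ltn_ceil.
  have := harmonic_sum_ge M t.-1.
  have : (2 ^ t = 2 * 2 ^ t.-1)%N by rewrite -expnS prednK //; lia.
  have h53 : (5 * (t.-1 * M) >= 3 * (t.+1 * M))%N by nia.
  set S := (\sum_(_ < _) _)%N; lia.
have [col hcol] := exists_coloring nsum.
apply: (@le_trans _ _ (K * M%:R)).
  apply: (@le_trans _ _ (fgraph_max (clique_union col) K)%:R).
    by rewrite ler_nat fmin_le.
  rewrite /fgraph_max; elim/big_ind: _ => [|x y hx hy|U].
  - by rewrite mulr_ge0 // (le_trans _ K1).
  - by rewrite /maxn; case: ifP.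
  - apply: nearly_regular_clique_union => // m.
    (* Colour [j] has at most [M %/ j.+1] vertices, so a class with [m] or more vertices has
       [m <= M %/ j.+1]. *)
    apply: leq_trans (card_harmonic_ge M (2 ^ t.-1) m); rewrite leq_mul2l.
    apply/orP; right; apply/subset_leq_card/subsetP => j; rewrite !inE.
    by move=> /leq_trans; apply.
have log_gt0 : 0 < log2 n%:R :> R.
  by rewrite divr_gt0 ?ln_gt0 ?ltr1n // (leq_trans _ n16).
rewrite [7 * K]mulrC -mulrA ler_pM2l ?(lt_le_trans _ K1) // mulrA.
rewrite ler_pdivlMr // -natrM.
(* The divisor [t + 1] in [M] serves here: [n < 2 ^ t.+1] bounds the logarithm by [t + 1], and
   [M (t + 1) <= 7 n]. *)
apply: (@le_trans _ _ (M%:R * t.+1%:R)).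
  by rewrite ler_wpM2l // log2_le // ltnW.
by rewrite -natrM ler_nat leq_divM.
Qed.
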